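(* Let $(M,d)$ be a Polish space, let $\mu$ be a Borel probability measure on $M$, and let $(X_n)_{n\in\mathbb{N}}$ be a sequence of i.i.d. $M$-valued random variables with distribution $\mu$. For $n\ge 1$ let $L_n=\frac1n\sum_{i=1}^n\delta_{X_i}$ be the empirical measure. Then the sequence $(L_n)_{n\in\mathbb{N}}$ satisfies a large deviations principle on the space $\mathcal{P}(M)$ of Borel probability measures on $M$ (with the weak topology) with rate function $H(\,\cdot\,|\mu)$; that is, for every open set $\mathcal{O}\subset\mathcal{P}(M)$, $$\liminf_{n\to\infty}\frac1n\log\mathbb{P}(L_n\in\mathcal{O})\ \ge\ -\inf_{\upsilon\in\mathcal{O}}H(\upsilon|\mu),$$ and for every closed set $\mathcal{C}\subset\mathcal{P}(M)$, $$\limsup_{n\to\infty}\frac1n\log\mathbb{P}(L_n\in\mathcal{C})\ \le\ -\inf_{\upsilon\in\mathcal{C}}H(\upsilon|\mu).$$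
   Context: $\delta_x$ denotes the point mass at $x$. The relative entropy of $\upsilon\in\mathcal{P}(M)$ with respect to $\mu\in\mathcal{P}(M)$ is $$H(\upsilon|\mu)=\sup\Big\{\int f\,d\upsilon-\log\int e^f\,d\mu:\ f:M\to\mathbb{R}\text{ measurable and bounded}\Big\}\in[0,\infty].$$ The weak topology on $\mathcal{P}(M)$ is the one generated by the maps $\upsilon\mapsto\int\varphi\,d\upsilon$ with $\varphi:M\to\mathbb{R}$ continuous and bounded; it is metrized by the bounded Lipschitz metric $d_{\rm BL}(\mu,\upsilon)=\sup\{|\int f\,d\upsilon-\int f\,d\mu|\}$, the supremum being over 1-Lipschitz $f:M\to\mathbb{R}$ with $|f|\le 1$. Conventions: $\log 0=-\infty$, $\inf\emptyset=+\infty$. *)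

(* Defs.v *)
From HB Require Import structures.
From mathcomp Require Import all_boot all_order all_algebra finmap.
From mathcomp Require Import all_classical all_reals all_analysis.

Set Implicit Arguments.
Unset Strict Implicit.
Unset Printing Implicit Defensive.

Import Order.TTheory GRing.Theory Num.Theory.
Import numFieldNormedType.Exports.

Local Open Scope classical_set_scope.
Local Open Scope ring_scope.

HB.mixin Record isSeparable T & Topological T := {
  separable : exists2 D : set T, countable D & dense D
}.

(* Complete separable metric spaces. CompletePseudoMetric brings a
   distinguished point, which measurableType requires; it is no restriction
   here, since a space carrying a probability measure is nonempty. *)
#[short(type="polishMetricType")]
HB.structure Definition PolishMetric (R : numDomainType) :=
  {T of CompletePseudoMetric R T & Metric R T & isSeparable T}.

Definition borel (T : ptopologicalType) : measurableType (@open T).-sigma :=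
  g_sigma_algebraType (@open T).

Section weak_topology.
Context (R : realType) (M : ptopologicalType).

Definition bounded_continuous :=
  {phi : M -> R | continuous phi /\ bounded_fun phi}.

Definition integral_of (phi : bounded_continuous)
  (nu : probability (borel M) R) : R := (\int[nu]_x sval phi x)%R.

(* P(M) with the coarsest topology making every integral_of phi continuous.
   Its elements are set functions on all subsets of M, so two of them may
   agree on every Borel set without being equal; they are then contained in
   the same open sets. *)
Definition weak_probability : Type := sup_topology
  (fun phi => Topological.class (initial_topology (integral_of phi))).

HB.instance Definition _ := Topological.on weak_probability.

End weak_topology.

Section relative_entropy.
Local Open Scope ereal_scope.
Context d (T : measurableType d) (R : realType).

Definition relative_entropy (nu mu : probability T R) : \bar R :=
  ereal_sup [set \int[nu]_x (f x)%:E - lne (\int[mu]_x (expR (f x))%:E)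
            | f in [set f : T -> R | measurable_fun setT f /\ bounded_fun f]].

End relative_entropy.

Section independence.
Local Open Scope ereal_scope.
Context d d' (Omega : measurableType d) (T : measurableType d') (R : realType).
Context (P : probability Omega R) (I : choiceType).

Definition mutually_independent (X : I -> {RV P >-> T}) : Prop :=
  forall (J : {fset I}) (A : I -> set T), (forall i, measurable (A i)) ->
    P (\bigcap_(i in [set` J]) (X i @^-1` A i)) =
    \prod_(i <- J) P (X i @^-1` A i).

End independence.

Section empirical_measure.
Context d (T : measurableType d) (R : realType).
Variables (x : nat -> T) (n : nat).

(* The empirical measure of the n.+1 points x 0, ..., x n. *)
Definition empirical_measure : set T -> \bar R :=
  mscale (n.+1%:R^-1)%:nng (msum (fun i => \d_(x i)) n.+1).

HB.instance Definition _ := Measure.on empirical_measure.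

Let empirical_measure_setT : empirical_measure setT = 1%E.
Proof.
rewrite /empirical_measure /mscale /= /msum.
rewrite (eq_bigr (fun=> 1%:E)); last by move=> i _; exact: diracT.
by rewrite sumEFin big_const_ord iter_addr addr0 -EFinM mulVf.
Qed.

HB.instance Definition _ :=
  Measure_isProbability.Build _ _ _ empirical_measure empirical_measure_setT.

End empirical_measure.

(* empirical_measure, seen as a point of P(M). *)
Definition empirical_point (R : realType) (M : ptopologicalType)
    (x : nat -> M) (n : nat) : weak_probability R M :=
  (@empirical_measure _ (borel M) R x n : probability (borel M) R).

(* Main.v *)
Require Import Defs.
From HB Require Import structures.
From mathcomp Require Import all_boot all_order all_algebra finmap.
From mathcomp Require Import all_classical all_reals all_analysis.
From mathcomp Require Import measurable_realfun ring lra.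

Set Implicit Arguments.
Unset Strict Implicit.
Unset Printing Implicit Defensive.

Import Order.TTheory GRing.Theory Num.Theory.
Import numFieldNormedType.Exports.

Local Open Scope classical_set_scope.
Local Open Scope ring_scope.

(* Fix a measurable map pi from M to a finite type. The word
   (pi X_0, ..., pi X_n) has a product law, so that large deviations of
   L_n along functions a \o pi are finite sums.

   Upper bound. If l < inf_C H(.|mu), then C is covered by finitely many sets
   {nu | int f dnu - log int e^f dmu > l} with f = a \o pi, and each of them has
   probability at most e^(-l n) by Chernoff. Otherwise an ultrafilter U
   containing C would satisfy int f dnu <= l + log int e^f dmu eventually for
   all such f. Then nu0(A) := lim_U nu(A) exists for every A and is finitely
   additive; taking f = t 1_A bounds t nu0(A) by
   l + log (1 + (e^t - 1) mu(A)), so nu0 is absolutely continuous with respect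
   to mu, hence countably additive. As nu0 is the weak limit of U, it lies in
   C, while H(nu0|mu) <= l. This compactness comes from the entropy bound
   alone, so neither Prokhorov's theorem nor exponential tightness is needed.

   Lower bound. A weak neighbourhood of nu contains the set of those nu' that
   almost agree with nu on finitely many functions a_i \o pi. If p and q are
   the laws of pi under mu and nu, a q-typical word has p-mass at least
   e^(-n (H(q|p) + e)) times its q-mass, the q-typical words have q-mass at
   least 1/2 by the law of large numbers, and H(q|p) <= H(nu|mu). *)

(** * Words over a finite alphabet *)

Section words.
Context {R : realType} {V : finType}.
Implicit Types (p q f : V -> R) (n : nat).

Definition word_mass p n (v : {ffun 'I_n -> V}) : R := \prod_i p (v i).

Lemma word_mass_ge0 p n v : (forall a, 0 <= p a) -> 0 <= @word_mass p n v.
Proof. by move=> p0; apply: prodr_ge0. Qed.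

Lemma sum_word_mass p n : \sum_v @word_mass p n v = (\sum_a p a) ^+ n.
Proof.
have <- : \prod_(i < n) \sum_a p a = (\sum_a p a) ^+ n.
  by rewrite prodr_const card_ord.
by rewrite (bigA_distr_bigA (fun=> p)).
Qed.

(** Exponential Markov inequality: on the event, [expR (\sum_i f (v i) - c * n%:R)] is at least 1,
    and the exponential moment over all words factors over the letters. *)
Lemma word_chernoff p f c n : (forall a, 0 <= p a) ->
  \sum_(v : {ffun 'I_n -> V} | c * n%:R <= \sum_i f (v i)) word_mass p v <=
  expR (- c * n%:R) * (\sum_a p a * expR (f a)) ^+ n.
Proof.
move=> p0; rewrite -sum_word_mass mulr_sumr.
rewrite [leRHS](bigID (fun v : {ffun 'I_n -> V} =>
  c * n%:R <= \sum_i f (v i))) /=.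
rewrite -[leLHS]addr0; apply: lerD; last first.
  apply: sumr_ge0 => v _; rewrite mulr_ge0 ?expR_ge0// word_mass_ge0// => a.
  by rewrite mulr_ge0 ?expR_ge0.
apply: ler_sum => v cv; rewrite /word_mass big_split/= -expR_sum mulrCA.
rewrite -expRD ler_peMr ?(word_mass_ge0 _ p0)// -[X in X <= _]expR0 ler_expR.
by rewrite mulNr addrC subr_ge0.
Qed.

(** Inverting [1 - x <= expR (- x)] gives [expR x <= (1 - x)^-1], and (1 - x)(1 + x + 2x^2) = 1 +
    x^2 (1 - 2x) is at least 1 when x <= 1/2. *)
Lemma expR_le_quad (x : R) : `|x| <= 2^-1 -> expR x <= 1 + x + 2 * x ^+ 2.
Proof.
move=> x1; have x12 : x <= 2^-1 by rewrite (le_trans (ler_norm _)).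
have x21 : - x <= 2^-1 by rewrite (le_trans (ler_norm _))// normrN.
have := expR_ge1Dx (- x); rewrite expRN => h.
have x_lt1 : 0 < 1 - x by lra.
rewrite -[expR x]invrK (le_trans (_ : _ <= (1 - x)^-1))//.
  by rewrite lef_pV2// posrE invr_gt0 expR_gt0.
rewrite -[leLHS]mul1r ler_pdivrMr//; nra.
Qed.

(** Chernoff's bound for the centred function scaled by a small [t]: centring removes the
    first-order term of the exponential moment, so the gain [t * e] beats the second-order cost. *)
Lemma word_lln p f e : (forall a, 0 <= p a) -> \sum_a p a = 1 -> 0 < e ->
  exists2 c, 0 < c & forall n,
  \sum_(v : {ffun 'I_n -> V} | (\sum_a p a * f a + e) * n%:R <= \sum_i f (v i))
    word_mass p v <= expR (- c * n%:R).
Proof.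
move=> p0 p1 e0; set m := \sum_a p a * f a.
pose g a := f a - m.
pose B := 1 + \sum_a `|g a|.
have B1 : 1 <= B by rewrite lerDl sumr_ge0.
have gB a : `|g a| <= B.
  rewrite /B (bigD1 a)//= addrCA lerDl addr_ge0// sumr_ge0//.
have pg0 : \sum_a p a * g a = 0.
  under eq_bigr do rewrite mulrBr.
  by rewrite sumrB -mulr_suml p1 mul1r subrr.
(* The first bound gives [t * B <= 2^-1], as [expR_le_quad] requires; the second makes the cost
   [2 * (t * B) ^+ 2] at most [t * e / 2], leaving the rate [t * e / 2]. *)
pose t := Num.min (B^-1 / 2) (e / (4 * B ^+ 2)).
have B0 : 0 < B by lra.
have t0 : 0 < t by rewrite lt_min !divr_gt0// ?invr_gt0// mulr_gt0// exprn_gt0.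
have tB : t * B <= 2^-1.
  by rewrite -ler_pdivlMr// mulrC ge_min lexx.
have te : t * (4 * B ^+ 2) <= e.
  by rewrite -ler_pdivlMr ?ge_min ?lexx ?orbT// mulr_gt0// exprn_gt0.
exists (t * e / 2); first by rewrite divr_gt0// mulr_gt0.
move=> n.
have := @word_chernoff p (fun a => t * g a) (t * e) n p0.
rewrite (eq_bigl (fun v : {ffun 'I_n -> V} =>
  (m + e) * n%:R <= \sum_i f (v i))); last first.
  move=> v; rewrite -mulr_sumr -mulrA ler_pM2l// sumrB sumr_const card_ord.
  by rewrite -[m *+ n]mulr_natr lerBrDl mulrDl.
move=> /le_trans; apply.
have key : \sum_a p a * expR (t * g a) <= expR (2 * (t * B) ^+ 2).
  apply: (@le_trans _ _ (\sum_a p a * (1 + t * g a + 2 * (t * B) ^+ 2))).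
    apply: ler_sum => a _; rewrite ler_wpM2l//.
    have tg : `|t * g a| <= t * B by rewrite normrM gtr0_norm// ler_wpM2l// ltW.
    rewrite (le_trans (expR_le_quad _)) ?(le_trans tg)// lerD2l ler_wpM2l//.
    by rewrite -real_normK ?num_real// lerXn2r ?nnegrE// mulr_ge0 ?ltW.
  rewrite (eq_bigr (fun a => p a + t * (p a * g a) + p a * (2 * (t * B) ^+ 2)));
    last by move=> a _; ring.
  rewrite !big_split/= -mulr_sumr pg0 mulr0 addr0 -mulr_suml p1 mul1r.
  exact: expR_ge1Dx.
have key2 :
    (\sum_a p a * expR (t * g a)) ^+ n <= expR (n%:R * (2 * (t * B) ^+ 2)).
  rewrite expRM_natl lerXn2r// ?nnegrE ?expR_ge0//.
  by apply: sumr_ge0 => a _; rewrite mulr_ge0 ?expR_ge0.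
apply: (le_trans (ler_wpM2l (expR_ge0 _) key2)).
rewrite -expRD ler_expR.
suff : n%:R * (2 * (t * B) ^+ 2) <= n%:R * (t * e / 2) :> R by lra.
rewrite ler_wpM2l//.
have : t * (t * (4 * B ^+ 2)) <= t * e by rewrite ler_wpM2l ?(ltW t0).
by rewrite exprMn; lra.
Qed.

End words.

(** * Change of measure on typical words *)

Section change_of_measure.
Context {R : realType} {V : finType}.
Variables (p q : V -> R).
Hypotheses (p_ge0 : forall a, 0 <= p a) (q_ge0 : forall a, 0 <= q a).
Hypothesis (q_sum : \sum_a q a = 1).
Hypothesis (qp : forall a, p a = 0 -> q a = 0).

(* By [qp] a letter with p a = 0 has q a = 0, so its junk quotient q a / 0
   does not contribute. *)
Definition kl : R := \sum_a q a * ln (q a / p a).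

Definition typical (fs : seq (V -> R)) e n (v : {ffun 'I_n -> V}) :=
  all (fun f => `|n%:R^-1 * \sum_i f (v i) - \sum_a q a * f a| < e) fs.

(** Letterwise, q exp(- ln (q / p)) equals p when q is nonzero. Only an inequality survives in
    general, because a letter with q = 0 may have positive p-mass. *)
Lemma word_mass_change n (v : {ffun 'I_n -> V}) :
  word_mass q v * expR (- \sum_i ln (q (v i) / p (v i))) <= word_mass p v.
Proof.
rewrite -sumrN expR_sum /word_mass -big_split/=.
apply: ler_prod => i _; rewrite mulr_ge0 ?expR_ge0//=.
have [->|q0] := eqVneq (q (v i)) 0; first by rewrite mul0r.
have p0 : p (v i) != 0 by apply: contra_neq q0; exact: qp.
have qgt : 0 < q (v i) by rewrite lt_def q0 q_ge0.
have pgt : 0 < p (v i) by rewrite lt_def p0 p_ge0.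
by rewrite expRN lnK ?posrE ?divr_gt0// invfM invrK mulrA divff// mul1r.
Qed.

Lemma cvg_expR_lt (c e : R) : 0 < c -> 0 < e ->
  exists N, forall n, (N <= n)%N -> expR (- c * n%:R) < e.
Proof.
move=> c0 e0; exists (Num.bound (c * e)^-1) => n Nn.
have : (c * e)^-1 < n%:R.
  apply: (lt_le_trans (archi_boundP _)); last by rewrite ler_nat.
  by rewrite invr_ge0 mulr_ge0 ?ltW.
rewrite -div1r ltr_pdivrMr ?mulr_gt0// => h.
rewrite mulNr expRN -[e]invrK ltf_pV2 ?posrE ?invr_gt0 ?expR_gt0//.
rewrite (lt_le_trans _ (expR_ge1Dx _))// -div1r ltr_pdivrMr//; nra.
Qed.

Lemma typical_large (fs : seq (V -> R)) (e : R) : 0 < e ->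
  exists N, forall n, (N <= n)%N ->
  2^-1 <= \sum_(v : {ffun 'I_n.+1 -> V} | typical fs e v) word_mass q v.
Proof.
move=> e0.
(* The complement is bounded by an arbitrary [t] so that the induction on [fs] goes through: one
   third of [t] pays for the tail of the list, one for upper deviations of [f], and one for lower
   deviations, seen as upper deviations of [- f]. *)
suff : forall t, 0 < t -> exists N, forall n, (N <= n)%N ->
    \sum_(v : {ffun 'I_n.+1 -> V} | ~~ typical fs e v) word_mass q v <= t.
  move=> /(_ (2^-1) ltac:(by rewrite invr_gt0))[N hN]; exists N => n /hN.
  have : \sum_(v : {ffun 'I_n.+1 -> V}) word_mass q v = 1.
    by rewrite sum_word_mass q_sum expr1n.
  by rewrite (bigID (fun v : {ffun 'I_n.+1 -> V} => typical fs e v))/=; lra.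
elim: fs => [t t0|f fs ih t t0].
  by exists 0 => n _; rewrite big1 ?ltW.
have t3 : 0 < t / 3 by rewrite divr_gt0.
have [N1 h1] := ih _ t3.
have [c c0 hc] := word_lln f q_ge0 q_sum e0.
have [d d0 hd] := word_lln (fun a => - f a) q_ge0 q_sum e0.
have [N2 h2] := cvg_expR_lt c0 t3.
have [N3 h3] := cvg_expR_lt d0 t3.
exists (maxn N1 (maxn N2 N3)) => n; rewrite !geq_max => /and3P[n1 n2 n3].
have n2' : (N2 <= n.+1)%N := leqW n2.
have n3' : (N3 <= n.+1)%N := leqW n3.
apply: (@le_trans _ _ (t / 3 + (t / 3 + t / 3))); last by lra.
apply: le_trans (lerD (h1 n n1) (lerD (le_trans (hc n.+1) (ltW (h2 _ n2')))
  (le_trans (hd n.+1) (ltW (h3 _ n3'))))).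
rewrite [leLHS]big_mkcond/= !(big_mkcond (fun v => _ <= _))/=.
rewrite [X in _ <= X + _]big_mkcond -!big_split/=.
apply: ler_sum => v _.
have w0 := word_mass_ge0 v q_ge0.
have n0 : 0 < n.+1%:R :> R by rewrite ltr0n.
have sN : \sum_i - f (v i) = - \sum_i f (v i) by rewrite sumrN.
have mN : \sum_a q a * - f a = - \sum_a q a * f a.
  by rewrite -sumrN; apply: eq_bigr => a _; rewrite mulrN.
rewrite sN mN; set s := \sum_i f (v i); set m := \sum_a q a * f a.
have if0 (b : bool) : 0 <= if b then word_mass q v else 0 by case: b.
case: ifPn => [|_]; last by rewrite !addr_ge0.
rewrite /typical/= negb_and => /orP[|->]; last by rewrite lerDl addr_ge0.
rewrite -/s -/m -leNgt ler_normr => h.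
suff /orP[->|->] : ((m + e) * n.+1%:R <= s) || ((- m + e) * n.+1%:R <= - s).
  by rewrite addrCA lerDl addr_ge0.
  by rewrite addrA lerDr addr_ge0.
have sE : s = n.+1%:R * (n.+1%:R^-1 * s) by rewrite mulrA divff ?mul1r ?gt_eqF.
clearbody s m; case/orP : h => h; apply/orP; [left|right];
  rewrite sE -?mulrN mulrC ler_pM2l// ?mulrN;
  by move: h; move: (_^-1 * s) => r h; lra.
Qed.

(** The log-likelihood ratio is added to the list of test functions. Its q-mean is [kl], so
    typicality bounds the exponent in [word_mass_change] by [(kl + e) * n.+1%:R]. *)
Lemma typical_lower_bound (fs : seq (V -> R)) (e : R) : 0 < e ->
  exists N, forall n, (N <= n)%N ->
  2^-1 * expR (- (kl + e) * n.+1%:R) <=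
  \sum_(v : {ffun 'I_n.+1 -> V} | typical fs e v) word_mass p v.
Proof.
move=> e0; pose h a := ln (q a / p a).
have [N hN] := typical_large (h :: fs) e0.
exists N => n /hN {}hN.
apply: (le_trans (ler_wpM2r (expR_ge0 _) hN)).
rewrite mulr_suml big_mkcond [leRHS]big_mkcond/=.
apply: ler_sum => v _; rewrite /typical/= -/(typical fs e v).
case: (typical fs e v); rewrite ?andbT ?andbF//.
case: ifPn => [hv|_]; last exact: word_mass_ge0.
apply: le_trans (word_mass_change v).
rewrite ler_wpM2l ?word_mass_ge0// ler_expR mulNr lerN2.
move: hv => /(le_lt_trans (ler_norm _)); rewrite ltrBlDl => /ltW.
by rewrite ler_pdivrMl ?ltr0n// mulrC.
Qed.

End change_of_measure.

(** * Finite measurable partitions *)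

Section finite_partition.
Context d {T : measurableType d} {R : realType} {V : finType}.

Definition fin_measurable (pi : T -> V) :=
  forall v, measurable (pi @^-1` [set v]).

Definition cell_mass (nu : probability T R) (pi : T -> V) (v : V) : R :=
  fine (nu (pi @^-1` [set v])).

Variables (pi : T -> V) (mpi : fin_measurable pi).
Implicit Type nu : probability T R.

Lemma fin_measurable_preimage (S : set V) : measurable (pi @^-1` S).
Proof.
rewrite (_ : _ @^-1` _ = \bigcup_(v in S) pi @^-1` [set v]).
  by apply: fin_bigcup_measurable => //; exact: finite_finset.
apply/seteqP; split=> [x Sx|x [v Sv xv]]; first by exists (pi x).
by rewrite /preimage/= (xv : pi x = v).
Qed.

Lemma fin_measurable_comp d' (T' : measurableType d') (a : V -> T') :
  measurable_fun setT (a \o pi).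
Proof.
by move=> _ Y mY; rewrite setTI comp_preimage; exact: fin_measurable_preimage.
Qed.

Lemma cell_mass_ge0 nu v : 0 <= cell_mass nu pi v.
Proof. exact: fine_ge0. Qed.

Lemma cell_massE nu v : nu (pi @^-1` [set v]) = (cell_mass nu pi v)%:E.
Proof. by rewrite fineK// fin_num_measure. Qed.

Lemma integral_fin_measurable nu (a : V -> R) :
  (\int[nu]_x (a (pi x))%:E = (\sum_v cell_mass nu pi v * a v)%:E)%E.
Proof.
transitivity (\int[nu]_x
    (\sum_v (a v)%:E * (\1_(pi @^-1` [set v]) x)%:E))%E.
  apply: eq_integral => x _; rewrite (bigD1 (pi x))//= big1 ?adde0.
    by rewrite indicE mem_set// mule1.
  move=> v vx; rewrite indicE memNset ?mule0//= => xv.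
  by rewrite -xv eqxx in vx.
have mi v : nu.-integrable setT (fun x => (\1_(pi @^-1` [set v]) x)%:E).
  exact: integrable_indic.
rewrite integral_sum//=; last by move=> v; exact: integrableZl.
rewrite -sumEFin; apply: eq_bigr => v _.
by rewrite integralZl// integral_indic//= setIT cell_massE -EFinM mulrC.
Qed.

Lemma Rintegral_fin_measurable nu (a : V -> R) :
  \int[nu]_x (a (pi x)) = \sum_v cell_mass nu pi v * a v.
Proof. by rewrite /Rintegral integral_fin_measurable. Qed.

Lemma measure_preimage_fin nu (S : pred V) :
  nu [set x | S (pi x)] = (\sum_(v | S v) cell_mass nu pi v)%:E.
Proof.
have mS : measurable [set x | S (pi x)].
  exact: (fin_measurable_preimage [set v | S v]).
rewrite -[LHS](_ : \int[nu]_x (\1_[set x | S (pi x)] x)%:E = _)%E; last first.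
  by rewrite integral_indic// setIT.
transitivity (\int[nu]_x ((S (pi x))%:R : R)%:E)%E.
  by apply: eq_integral => x _; rewrite indicE; congr (nat_of_bool _)%:R%:E;
    apply/idP/idP => [/set_mem//|/mem_set].
rewrite (integral_fin_measurable nu (fun v => (S v)%:R)) [in RHS]big_mkcond/=.
by congr EFin; apply: eq_bigr => v _; case: (S v); rewrite ?mulr1 ?mulr0.
Qed.

Lemma sum_cell_mass nu : \sum_v cell_mass nu pi v = 1.
Proof.
have := measure_preimage_fin nu predT; rewrite [X in nu X](_ : _ = setT)//.
  by rewrite probability_setT => -[].
by apply/seteqP; split.
Qed.

End finite_partition.

Lemma fin_measurable_pair d (T : measurableType d) (V W : finType)
    (pi : T -> V) (rho : T -> W) :
  fin_measurable pi -> fin_measurable rho ->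
  fin_measurable (fun x => (pi x, rho x)).
Proof.
move=> mpi mrho [v w].
rewrite (_ : _ @^-1` _ = pi @^-1` [set v] `&` rho @^-1` [set w]).
  exact: measurableI.
by apply/seteqP; split=> x /= [-> ->].
Qed.

(** * Bounded measurable functions and their finitely valued approximations *)

Section bounded_measurable.
Context d {T : measurableType d} {R : realType}.
Implicit Types (f g : T -> R) (nu : probability T R).

Definition bounded_measurable f := measurable_fun setT f /\ bounded_fun f.

Lemma bounded_fun_ex f : bounded_fun f <-> exists B : R, forall x, `|f x| <= B.
Proof.
split=> [[B [_ hB]]|[B hB]].
  by exists (B + 1) => x; apply: (hB (B + 1)) => //; rewrite ltrDl.
exists B; split; first exact: num_real.
by move=> r Br x _ /=; rewrite (le_trans (hB x))// ltW.
Qed.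

Lemma bounded_measurable_integrable nu f : bounded_measurable f ->
  nu.-integrable setT (EFin \o f).
Proof.
case=> mf bf; apply: measurable_bounded_integrable => //.
by rewrite ltey_eq fin_num_measure.
Qed.

Lemma bounded_measurable_EFin nu f : bounded_measurable f ->
  (\int[nu]_x (f x)%:E = (\int[nu]_x f x)%:E)%E.
Proof.
move=> /(bounded_measurable_integrable nu) fi.
by rewrite /Rintegral fineK//; exact: integrable_fin_num fi.
Qed.

Lemma bounded_measurable_expR f : bounded_measurable f ->
  bounded_measurable (expR \o f).
Proof.
case=> mf /bounded_fun_ex[B fB]; split.
  by apply: measurableT_comp => //; exact: measurable_expR.
apply/bounded_fun_ex; exists (expR B) => x.
by rewrite ger0_norm ?expR_ge0// ler_expR (le_trans (ler_norm _)).
Qed.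

Lemma bounded_measurable_fin (V : finType) (pi : T -> V) (a : V -> R) :
  fin_measurable pi -> bounded_measurable (a \o pi).
Proof.
move=> mpi; split; first exact: fin_measurable_comp.
apply/bounded_fun_ex; exists (\sum_v `|a v|) => x /=.
by rewrite (bigD1 (pi x))//= lerDl sumr_ge0.
Qed.

Lemma Rintegral_probability_cst nu (c : R) : \int[nu]_(x in setT) c = c.
Proof.
rewrite Rintegral_cst// [X in fine X](_ : _ = 1%E) ?mulr1//.
exact: probability_setT.
Qed.

Lemma bounded_measurable_cst (c : R) : bounded_measurable (fun=> c).
Proof. by split=> //; apply/bounded_fun_ex; exists `|c|. Qed.

Lemma Rintegral_close nu f g (e : R) :
  bounded_measurable f -> bounded_measurable g ->
  (forall x, `|f x - g x| <= e) -> `|\int[nu]_x f x - \int[nu]_x g x| <= e.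
Proof.
move=> bf bg fg.
have fi := bounded_measurable_integrable nu bf.
have gi := bounded_measurable_integrable nu bg.
rewrite -RintegralB//.
have bfg : bounded_measurable (fun x => f x - g x).
  split; first by apply: measurable_funB; [case: bf|case: bg].
  by apply/bounded_fun_ex; exists e.
have fgi := bounded_measurable_integrable nu bfg.
apply: (le_trans (le_normr_Rintegral _ fgi)) => //.
rewrite -[leRHS](Rintegral_probability_cst nu); apply: le_Rintegral => //.
  exact: integrable_norm fgi.
exact/bounded_measurable_integrable/bounded_measurable_cst.
Qed.

Lemma Rintegral_expR_gt0 nu f : bounded_measurable f ->
  0 < \int[nu]_x expR (f x).
Proof.
move=> bf; case: (bf) => _ /bounded_fun_ex[B fB].
apply: (@lt_le_trans _ _ (expR (- B))); first exact: expR_gt0.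
rewrite -[leLHS](Rintegral_probability_cst nu); apply: le_Rintegral => //.
- exact/bounded_measurable_integrable/bounded_measurable_cst.
- exact/bounded_measurable_integrable/bounded_measurable_expR.
- by move=> x _; rewrite ler_expR; have := fB x; rewrite ler_norml => /andP[].
Qed.

Lemma finite_approx f (e : R) : bounded_measurable f -> 0 < e ->
  exists (V : finType) (pi : T -> V) (a : V -> R),
  fin_measurable pi /\ forall x, `|f x - a (pi x)| <= e.
Proof.
case=> mf /bounded_fun_ex[B fB] e0.
(* The range of [f] is cut into steps of length [e]. The shift by [B] makes [g] nonnegative, so
   [Num.truncn] is its integer part, and [g x] is at most 2B/e, so [N.+1] codes suffice. *)
pose g x := (f x + B) / e.
have g0 x : 0 <= g x.
  rewrite divr_ge0 ?(ltW e0)// -lerBlDr sub0r.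
  by have := fB x; rewrite ler_norml => /andP[].
pose N := Num.truncn ((B + B) / e).
have gN x : (Num.truncn (g x) < N.+1)%N.
  rewrite ltnS; apply: le_truncn; rewrite ler_wpM2r ?invr_ge0 ?(ltW e0)//.
  by rewrite lerD2r (le_trans (ler_norm _)).
exists 'I_N.+1, (fun x => Ordinal (gN x)),
  (fun k : 'I_N.+1 => k%:R * e - B); split.
  move=> k.
  rewrite (_ : _ @^-1` _ = g @^-1` [set` `[(k%:R : R), k.+1%:R[]).
    rewrite -[_ @^-1` _]setTI.
    apply: (_ : measurable_fun setT g) => //.
    by apply: measurable_funM => //; exact: measurable_funD.
  apply/seteqP; split=> x /=; rewrite in_itv/=.
    by move=> /(congr1 val)/= <-; exact: truncn_itv.
  by move=> /truncn_def gk; exact/val_inj.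
move=> x /=; have /andP[] := truncn_itv (g0 x); set m := Num.truncn _.
rewrite ler_pdivlMr// ltr_pdivrMr// => h1; rewrite -natr1 => h2.
by rewrite ler_norml; apply/andP; split; lra.
Qed.

(** A single partition has to serve all the functions at once; it is the common refinement, obtained
    by pairing codes. *)
Lemma finite_approx_seq k (f : 'I_k -> T -> R) (e : R) :
  (forall i, bounded_measurable (f i)) -> 0 < e ->
  exists (V : finType) (pi : T -> V) (a : 'I_k -> V -> R),
  fin_measurable pi /\ forall i x, `|f i x - a i (pi x)| <= e.
Proof.
move=> bf e0; elim: k f bf => [|k ih] f bf.
  exists unit, (fun=> tt), (fun _ _ => 0); split; last by case.
  by case; rewrite (_ : _ @^-1` _ = setT)//; apply/seteqP; split.
have [V [pi [a [mpi ha]]]] := ih _ (fun i => bf (lift ord0 i)).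
have [W [rho [b [mrho hb]]]] := finite_approx (bf ord0) e0.
exists (V * W)%type, (fun x => (pi x, rho x)),
  (fun i v => if unlift ord0 i is Some j then a j v.1 else b v.2).
split=> [|i x]; first exact: fin_measurable_pair.
by case: unliftP => [j ->|->] /=; [exact: ha|exact: hb].
Qed.

End bounded_measurable.

Section relative_entropy_lemmas.
Context d {T : measurableType d} {R : realType}.
Implicit Types (f : T -> R) (nu mu : probability T R).

Lemma log_integral_EFin mu f : bounded_measurable f ->
  lne (\int[mu]_x (expR (f x))%:E)%E = (ln (\int[mu]_x expR (f x)))%:E.
Proof.
move=> bf; have bef := bounded_measurable_expR bf.
by rewrite (bounded_measurable_EFin _ bef) lne_EFin// Rintegral_expR_gt0.
Qed.

Lemma relative_entropy_ge nu mu f : bounded_measurable f ->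
  ((\int[nu]_x f x - ln (\int[mu]_x expR (f x)))%:E <=
    relative_entropy nu mu)%E.
Proof.
move=> bf; apply: ereal_sup_ubound; exists f => //.
by rewrite log_integral_EFin// bounded_measurable_EFin.
Qed.

Lemma relative_entropy_le nu mu (l : R) :
  (forall f, bounded_measurable f ->
    \int[nu]_x f x - ln (\int[mu]_x expR (f x)) <= l) ->
  (relative_entropy nu mu <= l%:E)%E.
Proof.
move=> h; apply: ge_ereal_sup => _ [f bf <-].
by rewrite log_integral_EFin// bounded_measurable_EFin// -EFinB lee_fin h.
Qed.

Lemma relative_entropy_ge0 nu mu : (0 <= relative_entropy nu mu)%E.
Proof.
apply: le_trans (relative_entropy_ge nu mu (bounded_measurable_cst 0)).
by rewrite !Rintegral_probability_cst expR0 ln1 subrr.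
Qed.

End relative_entropy_lemmas.

(** * Law of the words of an i.i.d. sequence *)

Section iid_words.
Context d d' {Omega : measurableType d} {T : measurableType d'} {R : realType}.
Context {P : probability Omega R} (X : nat -> {RV P >-> T}).
Context (mu : probability T R) {V : finType} (pi : T -> V).
Hypotheses (X_indep : mutually_independent X)
  (X_law : forall (i : nat) (A : set T), measurable A ->
     distribution P (X i) A = mu A)
  (mpi : fin_measurable pi).

Definition word_of n (w : Omega) : {ffun 'I_n -> V} :=
  [ffun i : 'I_n => pi (X i w)].

(** This is the shape in which [mutually_independent] applies: a finite set of naturals and a family
    of sets indexed by all naturals, equal to [setT] beyond the word. *)
Lemma word_of_preimage n (v : {ffun 'I_n -> V}) :
  @word_of n @^-1` [set v] =
  \bigcap_(i in [set` [fset i in iota 0 n]%fset])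
    (X i @^-1` (if insub i is Some j then pi @^-1` [set v j] else setT)).
Proof.
apply/seteqP; split=> w /=.
  move=> <- i /=; rewrite inE /= mem_iota add0n /= => ilt.
  by rewrite insubT/= ffunE.
move=> h; apply/ffunP => i; rewrite ffunE.
have := h i; rewrite /= valK; apply.
by rewrite inE /= mem_iota /= add0n ltn_ord.
Qed.

Lemma fin_measurable_word n : fin_measurable (@word_of n).
Proof.
move=> v; rewrite word_of_preimage; apply: fin_bigcap_measurable.
  exact: finite_fset.
move=> i _; rewrite -[X in measurable X]setTI; apply: measurable_funP => //.
by case: insub => // j; exact: mpi.
Qed.

Lemma cell_mass_word n (v : {ffun 'I_n -> V}) :
  cell_mass P (@word_of n) v = word_mass (cell_mass mu pi) v.
Proof.
rewrite /cell_mass word_of_preimage X_indep; last first.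
  by move=> i; case: insub => // j; exact: mpi.
rewrite (perm_big (iota 0 n)); last first.
  apply: uniq_perm; rewrite ?fset_uniq ?iota_uniq// => i.
  by rewrite inE.
rewrite -[n in iota 0 n]subn0 -/(index_iota 0 n) big_mkord.
rewrite (eq_bigr (fun i => (cell_mass mu pi (v i))%:E)); last first.
  move=> i _; rewrite valK -(cell_massE mpi); exact: X_law (mpi _).
by rewrite prodEFin.
Qed.

Lemma word_law n (S : pred {ffun 'I_n -> V}) :
  P [set w | S (word_of n w)] =
  (\sum_(v | S v) word_mass (cell_mass mu pi) v)%:E.
Proof.
rewrite (measure_preimage_fin (@fin_measurable_word n)).
by congr EFin; apply: eq_bigr => v _; exact: cell_mass_word.
Qed.

End iid_words.

Section empirical_integral.
Context d {T : measurableType d} {R : realType}.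

Lemma Rintegral_empirical (x : nat -> T) n (f : T -> R) :
  bounded_measurable f ->
  \int[(@empirical_measure _ T R x n : probability T R)]_y f y =
  n.+1%:R^-1 * \sum_(i < n.+1) f (x i).
Proof.
move=> bf; have [mf /bounded_fun_ex[B fB]] := bf.
set nu := (X in \int[X]_y _).
have fB0 y : 0 <= f y + B.
  by rewrite -lerBlDr sub0r; have := fB y; rewrite ler_norml => /andP[].
have mfB : measurable_fun setT (fun y => (f y + B)%:E).
  by apply/measurable_EFinP; exact: measurable_funD.
(* For the nonnegative integrand [f y + B] the integral splits along the scaling and the sum of
   point masses; [B] is cancelled from both sides at the end. *)
have : \int[nu]_y (f y + B) = n.+1%:R^-1 * \sum_(i < n.+1) (f (x i) + B).
  rewrite /Rintegral /nu /= /empirical_measure.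
  rewrite (ge0_integral_mscale _ measurableT)//;
    last by move=> y _; rewrite lee_fin.
  rewrite ge0_integral_measure_sum//; last by move=> y _; rewrite lee_fin.
  rewrite (eq_bigr (fun i : 'I_n.+1 => (f (x i) + B)%:E)); last first.
    move=> i _; apply: etrans (integral_dirac (x i) measurableT mfB) _.
    by rewrite diracT mul1e.
  by rewrite sumEFin.
rewrite RintegralD//; last 2 first.
- exact: bounded_measurable_integrable.
- exact/bounded_measurable_integrable/bounded_measurable_cst.
rewrite Rintegral_probability_cst big_split/= sumr_const card_ord mulrDr.
by rewrite -[B *+ _]mulr_natl mulrA mulVf// mul1r => /addIr.
Qed.

End empirical_integral.

(** * The weak topology and empirical measures *)

Section filter_limits.
Context {R : realType} {T : Type}.

Lemma cvg_sum (I : Type) (r : seq I) (F : set_system T) (f : I -> T -> R)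
    (l : I -> R) : Filter F -> (forall i, f i x @[x --> F] --> l i) ->
  \sum_(i <- r) f i x @[x --> F] --> \sum_(i <- r) l i.
Proof.
move=> FF fl; elim: r => [|i r ih].
  by rewrite big_nil; under eq_cvg do rewrite big_nil; exact: cvg_cst.
by rewrite big_cons; under eq_cvg do rewrite big_cons; exact: cvgD.
Qed.

Lemma cvg_near_le (F : set_system T) (f : T -> R) (a b : R) :
  ProperFilter F -> f x @[x --> F] --> a -> (\forall x \near F, f x <= b) ->
  a <= b.
Proof.
move=> FF fa fb.
exact: (closed_cvg (fun y => y <= b) (@closed_le R b) fb _ fa).
Qed.

End filter_limits.

Section weak_topology_lemmas.
Context {R : realType} {M : ptopologicalType}.

Lemma open_borel_measurable (U : set M) :
  open U -> measurable (U : set (borel M)).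
Proof. by move=> oU; exact: sub_sigma_algebra. Qed.

Lemma bounded_continuous_measurable (phi : bounded_continuous R M) :
  @bounded_measurable _ (borel M) R (sval phi).
Proof.
case: phi => f /= [cf bf]; split => //.
apply: (measurability _ (RGenOInfty.measurableE R)) => //.
move=> /= _ [_ [a ->] <-]; rewrite setTI; apply: open_borel_measurable.
by apply: open_comp => //; move=> x _; exact: cf.
Qed.

Lemma weak_cvg (F : set_system (weak_probability R M))
    (nu : weak_probability R M) : Filter F ->
  (forall phi, integral_of phi x @[x --> F] --> (integral_of phi nu : R)) ->
  F --> nu.
Proof.
move=> FF h; apply/cvg_sup => phi A.
rewrite (@nbhsE (initial_topology (integral_of phi))).
move=> -[B [[U oU UB] Bnu] BA].
apply: (filterS BA); rewrite -UB; apply: (h phi U).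
by apply: open_nbhs_nbhs; split => //; move: Bnu; rewrite -UB.
Qed.

End weak_topology_lemmas.

(** * Measurability of the empirical events *)

Section empirical_measurable.
Context {R : realType} {M : polishMetricType R}.

Lemma polish_second_countable : @second_countable M.
Proof.
have [D Dc Dd] := @separable R M.
exists (\bigcup_n (fun z : M => (ball z n.+1%:R^-1)^°) @` D).
  apply: bigcup_countable => // n _.
  exact: (card_le_trans (card_image_le _ _)).
split=> [_ [n _ [z _ <-]]|x A]; first exact: open_interior.
move=> /nbhs_ballP[e /= e0 eA].
(* With r < e/2 and a dense point [m] within r/2 of [x], the ball of radius r at [m] lies in the
   ball of radius e at [x] and has [x] in its interior. *)
have [//|n] := @ltr_add_invr R 0%R (e / 2) _; first by rewrite divr_gt0.
rewrite add0r; set r : R := n.+1%:R^-1 => re.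
have r0 : 0 < r by rewrite invr_gt0.
have [m [mx Dm]] : (ball x (r / 2))^° `&` D !=set0.
  apply: Dd; last exact: open_interior.
  by exists x; apply/nbhsx_ballx/divr_gt0.
have {}mx : ball m (r / 2) x by apply: ball_sym; exact: interior_subset mx.
exists ((ball m r)^°); last first.
  move=> y /interior_subset my; apply: eA.
  rewrite [e]splitr; apply: (@ball_triangle _ _ m).
    apply/ball_sym/(le_ball _ mx); rewrite (le_trans _ (ltW re))//.
    by rewrite ler_pdivrMr// ler_peMr ?(ltW r0)// ler1n.
  exact: le_ball (ltW re) _ my.
split; first by exists n => //; exists m.
apply/nbhs_ballP; exists (r / 2) => /=; first exact: divr_gt0.
by move=> y xy; rewrite [r]splitr; exact: ball_triangle xy.
Qed.

(** Neighbourhood filter of the first [n] coordinates in the product topology; the remaining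
    coordinates are free. *)
Definition near_prefix n (x : nat -> M) : set_system (nat -> M) :=
  [set S | exists2 A : 'I_n -> set M, (forall i : 'I_n, nbhs (x i) (A i)) &
    forall y : nat -> M, (forall i : 'I_n, A i (y i)) -> S y].

Lemma near_prefix_filter n x : Filter (near_prefix n x).
Proof.
split.
- by exists (fun=> setT) => // i; exact: filterT.
- move=> S S' [A xA AS] [A' xA' AS']; exists (fun i => A i `&` A' i).
    by move=> i; exact: filterI.
  by move=> y Ay; split; [apply: AS|apply: AS'] => i; have [] := Ay i.
- by move=> S S' SS' [A xA AS]; exists A => // y Ay; exact/SS'/AS.
Qed.

(** The integral of a continuous function against the empirical measure is an average of its values
    at the first [n.+1] points, hence continuous in them. *)
Lemma empirical_continuous n (x : nat -> M) (O : set (weak_probability R M)) :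
  open O -> O (empirical_point R x n) ->
  near_prefix n.+1 x [set y | O (empirical_point R y n)].
Proof.
move=> oO Ox.
have FF := near_prefix_filter n.+1 x.
suff : empirical_point R y n @[y --> near_prefix n.+1 x] -->
    empirical_point R x n by apply; exact: open_nbhs_nbhs.
apply: weak_cvg => phi.
have E y : integral_of phi (empirical_point R y n) =
    n.+1%:R^-1 * \sum_(i < n.+1) sval phi (y i).
  exact: (@Rintegral_empirical _ (borel M)) (bounded_continuous_measurable phi).
rewrite E.
apply: (@cvg_trans _ ((fun y : nat -> M =>
    n.+1%:R^-1 * \sum_(i < n.+1) sval phi (y i))
    @ near_prefix n.+1 x)).
  by move=> A /= hA; apply: filterS hA => y /=; rewrite -E.
apply: cvgMl_tmp; apply: cvg_sum => i.
have [cphi _] := svalP phi.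
apply: (@cvg_comp _ _ _ (fun y : nat -> M => y i) (sval phi) _ _ _ _ (cphi (x i))).
move=> A /= xA; exists (fun j => if j == i then A else setT).
  by move=> j; case: eqP => [->|_] //; exact: filterT.
by move=> y /(_ i); rewrite eqxx.
Qed.

(* The probability of a nonmeasurable set is a junk value, so the events in the
   theorem have to be shown measurable before P can be compared on them. *)
Lemma empirical_measurable d (Omega : measurableType d)
    (P : probability Omega R) (X : nat -> {RV P >-> borel M}) n
    (O : set (weak_probability R M)) : open O ->
  measurable [set w | O (empirical_point R (fun i => X i w) n)].
Proof.
move=> oO.
have [B Bc [Bo Bb]] := polish_second_countable.
have [g gB] : exists g : nat -> set M, forall A, B A -> exists k, g k = A.
  have /pfcard_geP[B0|[g]] := Bc.
    by exists (fun=> set0) => A; rewrite B0.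
  exists g => A BA; have [k _ kA] := @surj _ _ _ _ g _ BA.
  by exists k.
(* The event is open in the first [n.+1] samples, hence a union of boxes with sides in the countable
   base [B]. Only countably many index vectors [v] exist, and each box is a finite intersection of
   measurable events. *)
pose box (v : {ffun 'I_n.+1 -> nat}) (y : nat -> M) :=
  forall i : 'I_n.+1, g (v i) (y i).
pose G := [set y : nat -> M | O (empirical_point R y n)].
pose good v := box v `<=` G /\ forall i, B (g (v i)).
rewrite (_ : [set w | _] = \bigcup_(v : {ffun 'I_n.+1 -> nat})
    [set w | good v /\ box v (fun i => X i w)]).
  apply: countable_bigcupT_measurable => // v.
  have [gv|gv] := pselect (good v); last first.
    by rewrite (_ : [set w | _] = set0)//; apply/seteqP; split=> // w [].
  rewrite (_ : [set w | _] = \bigcap_(i : 'I_n.+1) (X i @^-1` (g (v i)))).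
    apply: fin_bigcap_measurable; first exact: finite_finset.
    move=> i _; rewrite -[X in measurable X]setTI.
    apply: measurable_funP => //; apply: open_borel_measurable.
    exact/Bo/gv.2.
  apply/seteqP; split=> [w [_ bw] i _|w bw]; first exact: bw.
  by split=> // i; exact: bw.
apply/seteqP; split=> [w /= Ow|w [v _ [[bG _] bw]]]; last exact: bG.
have [A xA AG] := empirical_continuous oO Ow.
have h (i : 'I_n.+1) : exists k, [/\ B (g k), g k (X i w) & g k `<=` A i].
  have [U [BU Ux] UA] := Bb _ _ (xA i).
  by have [k kU] := gB _ BU; exists k; rewrite kU.
exists [ffun i => projT1 (cid (h i))] => //; split.
  split=> [y by_|i]; last by rewrite ffunE; case: cid => k [].
  apply: AG => i; have := by_ i; rewrite ffunE; case: cid => k [_ _ kA] /=.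
  exact: kA.
by move=> i; rewrite ffunE; case: cid => k [].
Qed.

End empirical_measurable.

(** * Compactness of entropy sublevel sets along ultrafilters *)

Section probability_of_content.
Context d {T : measurableType d} {R : realType} (mu : probability T R).
Variable L : set T -> R.
Hypotheses (L_ge0 : forall A, 0 <= L A) (L_set0 : L set0 = 0)
  (L_setT : L setT = 1)
  (L_setU : forall A B, measurable A -> measurable B -> A `&` B = set0 ->
    L (A `|` B) = L A + L B)
  (L_cont : forall e : R, 0 < e -> exists2 c : R, 0 < c &
    forall A, measurable A -> fine (mu A) <= c -> L A <= e).

(** Stated for any additive [m] because it is applied both to [L] and to [mu], to compare their
    tails. *)
Lemma content_tail (m : set T -> R) (F : nat -> set T) n :
  (forall A B, measurable A -> measurable B -> A `&` B = set0 ->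
    m (A `|` B) = m A + m B) ->
  (forall i, measurable (F i)) -> trivIset setT F ->
  m (\bigcup_i F i) =
  \sum_(0 <= i < n) m (F i) + m (\bigcup_(i in [set i | (n <= i)%N]) F i).
Proof.
move=> mU mF tF; elim: n => [|n ih].
  by rewrite big_geq// add0r; congr m; apply: eq_bigcupl; split.
rewrite big_nat_recr//= ih -addrA -mU//; last 2 first.
- by apply: bigcup_measurable => i _; exact: mF.
- apply/seteqP; split=> // x [Fnx [i /= ni Fix]].
  have nE : n = i by apply: tF => //; exists x.
  by rewrite nE ltnn in ni.
congr (_ + m _).
apply/seteqP; split=> [x [i /= ni Fix]|x [Fnx|[i /= ni Fix]]].
- by move: ni; rewrite leq_eqVlt => /orP[/eqP ->|ni]; [left|right; exists i].
- by exists n => /=.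
- by exists i => //=; exact: ltnW.
Qed.

Let nu (A : set T) : \bar R := (L A)%:E.

Let nu_ge0 A : (0 <= nu A)%E. Proof. by rewrite lee_fin. Qed.

Let nu_set0 : nu set0 = 0%E. Proof. by rewrite /nu L_set0. Qed.

(** The defect of the n-th partial sum is the [L]-mass of the tail union. The [mu]-mass of that tail
    tends to 0, and [L_cont] transfers this to [L]. *)
Let nu_sigma_additive : semi_sigma_additive nu.
Proof.
move=> F mF tF mUF.
have muU A B : measurable A -> measurable B -> A `&` B = set0 ->
    fine (mu (A `|` B)) = fine (mu A) + fine (mu B).
  by move=> mA mB AB; rewrite measureU// fineD// fin_num_measure.
rewrite /nu; under eq_fun do rewrite sumEFin.
apply/cvg_EFin; first by near=> n.
apply/cvgrPdist_le => e e0; rewrite /=.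
have [c c0 hc] := L_cont e0.
have := @measure_semi_sigma_additive _ _ _ mu F mF tF mUF.
rewrite (_ : (fun n => _) =
    (fun n => (\sum_(0 <= i < n) fine (mu (F i)))%:E)); last first.
  apply/funext => n; rewrite -sumEFin; apply: eq_bigr => i _.
  by rewrite fineK// fin_num_measure.
rewrite -[X in _ --> X]fineK ?fin_num_measure// => /fine_cvgP[_].
move=> /cvgrPdist_le /(_ c c0) hn.
near=> n.
have -> : L (\bigcup_i F i) - \sum_(0 <= i < n) L (F i) =
    L (\bigcup_(i in [set i | (n <= i)%N]) F i).
  by rewrite (content_tail n L_setU mF tF) addrC addKr.
rewrite ger0_norm//; apply: hc.
  by apply: bigcup_measurable => i _; exact: mF.
have : `|fine (mu (\bigcup_i F i)) - \sum_(0 <= i < n) fine (mu (F i))| <= c.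
  by near: n.
rewrite [fine (mu (\bigcup_i F i))](content_tail n muU mF tF) addrC addKr.
by move=> /(le_trans (ler_norm _)).
Unshelve. all: by end_near. Qed.

HB.instance Definition _ := isMeasure.Build _ _ _ nu
  nu_set0 nu_ge0 nu_sigma_additive.

Let nu_setT : nu setT = 1%E. Proof. by rewrite /nu L_setT. Qed.

HB.instance Definition _ := Measure_isProbability.Build _ _ _ nu nu_setT.

Lemma probability_of_content :
  exists nu0 : probability T R, forall A, nu0 A = (L A)%:E.
Proof. by exists nu. Qed.

End probability_of_content.

Section ultrafilter_limit.
Context d {T : measurableType d} {R : realType} (mu : probability T R) (l : R).

(** Over all bounded measurable [f], these sets intersect in the entropy sublevel set H(.|mu) <=
    l. *)
Definition entropy_halfspace (f : T -> R) : set (probability T R) :=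
  [set nu | \int[nu]_x f x - ln (\int[mu]_x expR (f x)) <= l].

(** Compactness of [a, b] yields a cluster point of the image of [U], and a cluster point of an
    ultrafilter is a limit. *)
Lemma ultra_bounded_cvg S (U : set_system S) (g : S -> R) (a b : R) :
  UltraFilter U -> (forall x, a <= g x <= b) ->
  exists2 c, a <= c <= b & g x @[x --> U] --> c.
Proof.
move=> UU gab.
have gU : ProperFilter (g @ U) by exact: fmap_proper_filter.
have [|c [cab gc]] := @segment_compact R a b (g @ U) gU.
  by apply: (@filterE _ U) => x; rewrite /preimage/= in_itv; exact: gab.
exists c; first by move: cab; rewrite /= in_itv.
move=> A cA; have [//|gA] := in_ultra_setVsetC (g @^-1` A) UU.
have [y []] := gc (~` A) A gA cA.
by [].
Qed.

Section limit_measure.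
Variables (S : Type) (U : set_system S) (UU : UltraFilter U).
Variable (nu_ : S -> probability T R).

(* On a nonmeasurable set nu_ s is unconstrained: the truncation gives
   every set a limit along U, and is the identity on measurable sets. *)
Let clip A s : R := Num.min 1 (fine (nu_ s A)).

Let clip01 A s : 0 <= clip A s <= 1.
Proof. by rewrite /clip le_min ler01 fine_ge0//= ge_min lexx. Qed.

Let clipE A s : measurable A -> clip A s = fine (nu_ s A).
Proof.
move=> mA; apply/min_idPr; rewrite -lee_fin fineK ?fin_num_measure//.
exact: probability_le1.
Qed.

Let L A := projT1 (cid2 (ultra_bounded_cvg UU (clip01 A))).

Let L01 A : 0 <= L A <= 1.
Proof. by rewrite /L; case: cid2. Qed.

Let L_cvg A : clip A s @[s --> U] --> L A.
Proof. by rewrite /L; case: cid2. Qed.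

Let L_cvg_measure A : measurable A -> fine (nu_ s A) @[s --> U] --> L A.
Proof. by move=> mA; under eq_cvg do rewrite -clipE//; exact: L_cvg. Qed.

Hypothesis nu_halfspace : forall (V : finType) (pi : T -> V) (a : V -> R),
  fin_measurable pi -> \forall s \near U, entropy_halfspace (a \o pi) (nu_ s).

(** The halfspace of t 1_A, a function of the two-cell partition by membership in [A], passes to the
    limit; the integral of exp(t 1_A) is 1 + (e^t - 1) mu(A). *)
Let L_entropy A (t : R) : measurable A ->
  t * L A <= l + ln (1 + (expR t - 1) * fine (mu A)).
Proof.
move=> mA; pose pi x := x \in A.
have piA : pi @^-1` [set true] = A.
  by apply/seteqP; split=> x; [move=> /set_mem|move=> /mem_set].
have piAC : pi @^-1` [set false] = ~` A.
  apply/seteqP; split=> x; first by move=> /negbT /negP xA /mem_set.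
  by move=> xA; apply/negbTE/negP => /set_mem.
have mpi : fin_measurable pi by case; rewrite ?piA ?piAC//; exact: measurableC.
have h := nu_halfspace (fun b : bool => t * b%:R) mpi.
have tL : t * fine (nu_ s A) @[s --> U] --> t * L A.
  by apply: cvgMl_tmp; exact: L_cvg_measure.
apply: (cvg_near_le _ tL).
apply: filterS h => s; rewrite /entropy_halfspace/=.
rewrite (Rintegral_fin_measurable mpi (nu_ s) (fun b : bool => t * b%:R)).
rewrite (Rintegral_fin_measurable mpi mu (fun b : bool => expR (t * b%:R))).
have := sum_cell_mass mpi mu.
rewrite !big_bool/= !mulr0 addr0 !mulr1 expR0 mulr1 /cell_mass piA.
move=> h1 h2; rewrite mulrC -lerBlDr (le_trans _ h2)// lerB//.
by rewrite le_eqVlt; apply/orP; left; apply/eqP; congr ln; lra.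
Qed.

Lemma ultra_limit_measure : exists nu0 : probability T R,
  forall A, measurable A -> fine (nu_ s A) @[s --> U] --> fine (nu0 A).
Proof.
have L_lim A c : measurable A -> fine (nu_ s A) @[s --> U] --> c -> L A = c.
  by move=> mA; apply: cvg_unique => //; exact: L_cvg_measure.
have [|||||nu0 nu0E] := @probability_of_content d T R mu L.
- by move=> A; have /andP[] := L01 A.
- by apply: L_lim => //; under eq_cvg do rewrite measure0; exact: cvg_cst.
- apply: L_lim => //; under eq_cvg do rewrite probability_setT.
  exact: cvg_cst.
- move=> A B mA mB AB; apply: L_lim; first exact: measurableU.
  under eq_cvg do rewrite measureU// fineD ?fin_num_measure//.
  by apply: cvgD; exact: L_cvg_measure.
(* With mu(A) at most 1/(e^t - 1), the logarithm in [L_entropy] is at most 1, whence t L(A) <= |l| +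
   1, which is L(A) <= e. *)
- move=> e e0; pose t := (`|l| + 1) / e.
  have t0 : 0 < t by rewrite divr_gt0// ltr_wpDl.
  have et : 0 < expR t - 1 by rewrite subr_gt0 expR_gt1.
  exists (expR t - 1)^-1; first by rewrite invr_gt0.
  move=> A mA muA; have := L_entropy t mA.
  have m0 : 0 <= fine (mu A) by rewrite fine_ge0.
  have h1 : (expR t - 1) * fine (mu A) <= 1 by rewrite -ler_pdivlMl// mulr1.
  have h0 : 0 <= (expR t - 1) * fine (mu A) by rewrite mulr_ge0// ltW.
  move=> h; have {h} : t * L A <= `|l| + 1.
    rewrite (le_trans h)// lerD ?ler_norm// (le_trans (le_ln1Dx _))//.
    by rewrite (lt_le_trans _ h0)// ltrN10.
  by rewrite /t mulrAC ler_pdivrMr// ler_pM2l// ltr_wpDl.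
exists nu0 => A mA; rewrite nu0E; exact: L_cvg_measure.
Qed.

End limit_measure.

End ultrafilter_limit.

(** Merges two finite lists of test functions, which makes the filters defined below by finitely
    many conditions stable under intersection. *)
Lemma cat_family (A : Type) k k' (f : 'I_k -> A) (f' : 'I_k' -> A) :
  exists2 g : 'I_(k + k') -> A,
    (forall i, g (lshift k' i) = f i) /\ (forall i, g (rshift k i) = f' i) &
    forall Q : A -> Prop, (forall i, Q (f i)) -> (forall i, Q (f' i)) ->
      forall i, Q (g i).
Proof.
exists (fun i => match fintype.split i with inl j => f j | inr j => f' j end).
  by split=> i; [rewrite (unsplitK (inl i))|rewrite (unsplitK (inr i))].
by move=> Q Qf Qf' i; case: fintype.split.
Qed.

Section limit_functionals.
Context d {T : measurableType d} {R : realType} (mu : probability T R) (l : R).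
Variables (S : Type) (U : set_system S).
Hypothesis UF : ProperFilter U.
Variables (nu_ : S -> probability T R) (nu0 : probability T R).
Hypothesis nu_cvg : forall A, measurable A ->
  fine (nu_ s A) @[s --> U] --> fine (nu0 A).

Lemma cvg_Rintegral_fin (V : finType) (pi : T -> V) (a : V -> R) :
  fin_measurable pi ->
  \int[nu_ s]_x a (pi x) @[s --> U] --> \int[nu0]_x a (pi x).
Proof.
move=> mpi; rewrite Rintegral_fin_measurable//.
under eq_cvg do rewrite Rintegral_fin_measurable//.
by apply: cvg_sum => v; apply: cvgMr_tmp; exact: nu_cvg.
Qed.

(** Setwise convergence handles finitely valued functions; a uniform approximation within e/3
    extends it to [f]. *)
Lemma cvg_Rintegral f : bounded_measurable f ->
  \int[nu_ s]_x f x @[s --> U] --> \int[nu0]_x f x.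
Proof.
move=> bf; apply/cvgrPdist_le => e e0.
have e3 : 0 < e / 3 by rewrite divr_gt0.
have [V [pi [a [mpi fa]]]] := finite_approx bf e3.
have ba := bounded_measurable_fin a mpi.
have /cvgrPdist_le/(_ _ e3) := cvg_Rintegral_fin (a := a) mpi.
apply: filterS => s h.
have := Rintegral_close nu0 bf ba fa; have := Rintegral_close (nu_ s) bf ba fa.
rewrite /=; move: h; rewrite !ler_norml => /andP[? ?] /andP[? ?] /andP[? ?].
by apply/andP; split; lra.
Qed.

Hypothesis nu_halfspace : forall (V : finType) (pi : T -> V) (a : V -> R),
  fin_measurable pi ->
  \forall s \near U, entropy_halfspace mu l (a \o pi) (nu_ s).

(** The halfspaces are available for finitely valued functions only. Replacing [f] by an
    approximation within e/2 changes the integral and the log-integral by at most e/2 each. *)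
Lemma relative_entropy_limit : (relative_entropy nu0 mu <= l%:E)%E.
Proof.
apply: relative_entropy_le => f bf; apply/ler_addgt0Pr => e e0.
have e2 : 0 < e / 2 by rewrite divr_gt0.
have [V [pi [a [mpi fa]]]] := finite_approx bf e2.
have ba := bounded_measurable_fin a mpi.
have h1 : \int[nu0]_x a (pi x) <= l + ln (\int[mu]_x expR (a (pi x))).
  apply: (cvg_near_le _ (cvg_Rintegral_fin (a := a) mpi)).
  apply: filterS (nu_halfspace a mpi) => s.
  by rewrite /entropy_halfspace/= lerBlDr.
have h2 : ln (\int[mu]_x expR (a (pi x))) <= e / 2 + ln (\int[mu]_x expR (f x)).
  rewrite -[e / 2]expRK -lnM ?posrE ?expR_gt0 ?Rintegral_expR_gt0//.
  rewrite ler_ln ?posrE ?mulr_gt0 ?expR_gt0 ?Rintegral_expR_gt0//.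
  have bef := bounded_measurable_expR bf.
  rewrite -RintegralZl//; last exact: bounded_measurable_integrable bef.
  apply: le_Rintegral => //.
  - exact/bounded_measurable_integrable/(bounded_measurable_expR ba).
  - exact: (integrableZl measurableT _ (bounded_measurable_integrable mu bef)).
  - move=> x _; rewrite -expRD ler_expR -lerBlDr.
    by have := fa x; rewrite distrC => /(le_trans (ler_norm _)).
have := Rintegral_close nu0 bf ba fa; rewrite ler_norml => /andP[_] /=; lra.
Qed.

End limit_functionals.

Section finite_halfspace_cover.
Context {R : realType} {M : ptopologicalType} (mu : probability (borel M) R).

Definition fin_simple d (T : measurableType d) (f : T -> R) :=
  exists (V : finType) (pi : T -> V) (a : V -> R),
    fin_measurable pi /\ f = a \o pi.

Lemma finite_halfspace_cover (C : set (weak_probability R M)) (l : R) :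
  closed C ->
  (forall nu, C nu -> (l%:E < relative_entropy (nu : probability _ _) mu)%E) ->
  exists k (f : 'I_k -> borel M -> R), (forall i, fin_simple (f i)) /\
    forall nu, C nu -> exists i, ~ entropy_halfspace mu l (f i) nu.
Proof.
move=> cC lC; apply: contrapT => nocover.
(* The filter generated by [C] and the halfspaces; it is proper precisely because no finite cover
   exists. *)
pose F : set_system (weak_probability R M) :=
  [set S | exists k (f : 'I_k -> borel M -> R), (forall i, fin_simple (f i)) /\
     forall nu, C nu -> (forall i, entropy_halfspace mu l (f i) nu) -> S nu].
have FC : F C by exists 0%N, (fun _ _ => 0); split=> // -[].
have FF : ProperFilter F.
  split.
    move=> [k [f [sf h]]]; apply: nocover; exists k, f; split=> // nu Cnu.
    by apply: contrapT => /forallNP fnu; apply: (h nu Cnu) => i;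
      exact: contrapT (fnu i).
  split.
  - by exists 0%N, (fun _ _ => 0); split=> // -[].
  - move=> S S' [k [f [sf fS]]] [k' [f' [sf' fS']]].
    have [g [gf gf'] gP] := cat_family f f'.
    exists (k + k')%N, g; split=> [|nu Cnu h]; first exact: gP.
    by split; [apply: fS => // i; rewrite -gf|apply: fS' => // i; rewrite -gf'].
  - move=> S S' SS' [k [f [sf fS]]]; exists k, f; split=> // nu Cnu.
    by move=> /(fS _ Cnu)/SS'.
have [U [UU FU]] := ultraFilterLemma FF.
have Uhalf (V : finType) (pi : borel M -> V) (a : V -> R) : fin_measurable pi ->
    U [set nu | entropy_halfspace mu l (a \o pi) nu].
  move=> mpi; apply: FU; exists 1%N, (fun=> a \o pi); split.
    by move=> _; exists V, pi, a.
  by move=> nu _ /(_ ord0).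
have [nu0 nu0_lim] := ultra_limit_measure (l := l) (nu_ := id) UU Uhalf.
have Unu0 : U --> (nu0 : weak_probability R M).
  apply: weak_cvg => phi.
  exact: (cvg_Rintegral _ nu0_lim (bounded_continuous_measurable phi)).
have Cnu0 : C nu0.
  apply: cC => A nu0A; have /filterI : U C by exact: FU.
  by move=> /(_ _ (Unu0 _ nu0A)) /filter_ex.
have := lC _ Cnu0; rewrite ltNge => /negP; apply.
exact: (relative_entropy_limit _ nu0_lim Uhalf).
Qed.

End finite_halfspace_cover.

(** * Large deviation bounds *)

Section limsup_of_rates.
Context {R : realType}.
Implicit Types (u : nat -> \bar R) (a : R).

Lemma limn_esup_le u (a : \bar R) :
  (exists N, forall n, (N <= n)%N -> (u n <= a)%E) -> (limn_esup u <= a)%E.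
Proof.
move=> [N uN].
apply: (@le_trans _ _ (ereal_sup [set u n | n in [set n | (N <= n)%N]])).
  by apply: ereal_inf_lbound; exists [set n | (N <= n)%N] => //; exists N.
by apply: ge_ereal_sup => _ [n Nn <-]; exact: uN.
Qed.

Lemma limn_einf_ge u (a : \bar R) :
  (exists N, forall n, (N <= n)%N -> (a <= u n)%E) -> (a <= limn_einf u)%E.
Proof.
move=> [N uN]; rewrite /limn_einf leeNr; apply: limn_esup_le.
by exists N => n /uN; rewrite leeN2.
Qed.

Lemma lee_forall_lt (x y : \bar R) :
  (forall r : R, (r%:E < x)%E -> (r%:E <= y)%E) -> (x <= y)%E.
Proof.
case: x => [x| |] h; last by rewrite leNye.
- apply/lee_subgt0Pr => e e0; rewrite -EFinB; apply: h.
  by rewrite lte_fin ltrBlDr ltrDl.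
- case: y h => [y| |] h //; last by have := h 0 (ltry _).
  by have := h (y + 1) (ltry _); rewrite lee_fin gerDl ler10.
Qed.

(** Absorbs the constant prefactors of the probability bounds, which contribute only ln K / n to the
    rate. *)
Lemma divn_eventually_le (c e : R) : 0 < e ->
  exists N, forall n, (N <= n)%N -> c * n.+1%:R^-1 <= e.
Proof.
move=> e0; exists (Num.bound (`|c| / e)) => n Nn.
rewrite ler_pdivrMr// -ler_pdivrMl// mulrC.
rewrite (@le_trans _ _ (`|c| / e))//.
  by rewrite ler_wpM2r ?ler_norm// invr_ge0 ltW.
have ce0 : 0 <= `|c| / e by rewrite divr_ge0 ?(ltW e0).
apply: (le_trans (ltW (archi_boundP ce0))).
by rewrite ler_nat ltnW.
Qed.

Let lne_expR (K h : R) n : 0 < K ->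
  ((n.+1%:R^-1)%:E * lne (K * expR (- h * n.+1%:R))%:E)%E =
  (ln K * n.+1%:R^-1 - h)%:E.
Proof.
move=> K0; rewrite lne_EFin ?mulr_gt0 ?expR_gt0// lnM ?posrE ?expR_gt0// expRK.
rewrite -EFinM mulrDr mulrC; congr (_ + _)%:E.
by rewrite mulrCA mulVf ?mulr1.
Qed.

Lemma rate_le (K h : R) n (x : \bar R) : 0 < K ->
  (0 <= x)%E -> (x <= (K * expR (- h * n.+1%:R))%:E)%E ->
  ((n.+1%:R^-1)%:E * lne x <= (ln K * n.+1%:R^-1 - h)%:E)%E.
Proof.
move=> K0 x0 xK; rewrite -lne_expR//.
apply: lee_wpmul2l; first by rewrite lee_fin.
by rewrite lee_lne ?in_itv/= ?leey ?andbT// (le_trans x0).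
Qed.

Lemma rate_ge (K h : R) n (x : \bar R) : 0 < K ->
  ((K * expR (- h * n.+1%:R))%:E <= x)%E ->
  ((ln K * n.+1%:R^-1 - h)%:E <= (n.+1%:R^-1)%:E * lne x)%E.
Proof.
move=> K0 xK; rewrite -lne_expR//.
apply: lee_wpmul2l; first by rewrite lee_fin.
have K1 : (0 <= (K * expR (- h * n.+1%:R))%:E)%E.
  by rewrite lee_fin mulr_ge0 ?expR_ge0 ?ltW.
by rewrite lee_lne ?in_itv/= ?leey ?andbT// (le_trans K1).
Qed.

End limsup_of_rates.

Section iid_empirical.
Context d d' {Omega : measurableType d} {T : measurableType d'} {R : realType}.
Context {P : probability Omega R} (X : nat -> {RV P >-> T}).
Context (mu : probability T R).
Hypotheses (X_indep : mutually_independent X)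
  (X_law : forall (i : nat) (A : set T), measurable A ->
     distribution P (X i) A = mu A).

Let emp w n : probability T R := @empirical_measure _ T R (fun i => X i w) n.

Lemma Rintegral_empirical_word (V : finType) (pi : T -> V) (a : V -> R) w n :
  fin_measurable pi ->
  \int[emp w n]_x a (pi x) =
  n.+1%:R^-1 * \sum_(i < n.+1) a (word_of X pi n.+1 w i).
Proof.
move=> mpi; rewrite (Rintegral_empirical _ _ (bounded_measurable_fin a mpi)).
by congr (_ * _); apply: eq_bigr => i _; rewrite ffunE.
Qed.

(** The event says that the mean of [a] along the word exceeds l + ln Z. Chernoff at that level
    gives exp(- (l + ln Z) n) Z^n, where the normalisation Z cancels. *)
Lemma iid_chernoff (f : T -> R) (l : R) n : fin_simple f ->
  let E := [set w | ~ entropy_halfspace mu l f (emp w n)] in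
  measurable E /\ (P E <= (expR (- l * n.+1%:R))%:E)%E.
Proof.
move=> [V [pi [a [mpi ->]]]] E.
pose p := cell_mass mu pi.
pose Z := \sum_v p v * expR (a v).
have ZE : \int[mu]_x expR (a (pi x)) = Z.
  by rewrite (Rintegral_fin_measurable mpi mu (expR \o a)).
have Z0 : 0 < Z.
  by rewrite -ZE (Rintegral_expR_gt0 mu (bounded_measurable_fin a mpi)).
pose S (v : {ffun 'I_n.+1 -> V}) := l + ln Z < n.+1%:R^-1 * \sum_i a (v i).
have -> : E = [set w | S (word_of X pi n.+1 w)].
  apply/seteqP; split=> w; rewrite /E /entropy_halfspace /S/=;
    rewrite Rintegral_empirical_word// ZE lerBlDr.
    by move=> /negP; rewrite -ltNge.
  by rewrite ltNge => /negP.
split.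
  exact: (fin_measurable_preimage (fin_measurable_word X mpi (n := n.+1))
    [set v | S v]).
rewrite (word_law X_indep X_law mpi) lee_fin.
apply: (@le_trans _ _ (\sum_(v : {ffun 'I_n.+1 -> V} |
    (l + ln Z) * n.+1%:R <= \sum_i a (v i)) word_mass p v)).
  rewrite big_mkcond [leRHS]big_mkcond/=; apply: ler_sum => v _.
  have w0 : 0 <= word_mass p v.
    by apply: word_mass_ge0 => u; exact: cell_mass_ge0.
  rewrite /S ltr_pdivlMl// [_ * (l + _)]mulrC.
  by case: ifP => [/ltW ->//|_]; case: ifP.
have p0 u : 0 <= p u by exact: cell_mass_ge0.
apply: (le_trans (word_chernoff a (l + ln Z) n.+1 p0)).
rewrite -/Z -[Z ^+ _](_ : expR (n.+1%:R * ln Z) = _); last first.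
  by rewrite expRM_natl lnK.
by rewrite -expRD ler_expR; lra.
Qed.

End iid_empirical.

(** * Entropy restricted to a finite partition *)

Section entropy_of_partition.
Context d {T : measurableType d} {R : realType} (nu mu : probability T R).
Context {V : finType} (pi : T -> V) (mpi : fin_measurable pi) (h : R).
Hypothesis nu_entropy : (relative_entropy nu mu <= h%:E)%E.

Let p := cell_mass mu pi.
Let q := cell_mass nu pi.

Lemma cell_entropy (f : V -> R) :
  \sum_v q v * f v - ln (\sum_v p v * expR (f v)) <= h.
Proof.
rewrite -lee_fin; apply: le_trans nu_entropy.
apply: le_trans (relative_entropy_ge nu mu (bounded_measurable_fin f mpi)).
by rewrite (Rintegral_fin_measurable mpi nu f)
  (Rintegral_fin_measurable mpi mu (expR \o f)).
Qed.

Lemma cell_abs_cont v : p v = 0 -> q v = 0.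
Proof.
move=> pv0; apply/eqP/negPn/negP => qv0.
have qv : 0 < q v by rewrite lt_def qv0 cell_mass_ge0.
(* Tested at t times the indicator of the cell [v], which is [mu]-null, the log-integral vanishes
   and the bound reads t q(v) <= h; this [t] makes the left side |h| + 1. *)
pose t := (`|h| + 1) / q v.
have := cell_entropy (fun u => if u == v then t else 0).
rewrite (eq_bigr (fun u => if u == v then q u * t else 0)); last first.
  by move=> u _; case: eqP => //; rewrite mulr0.
rewrite -big_mkcond big_pred1_eq (eq_bigr p); last first.
  by move=> u _; case: eqP => [->|_]; rewrite ?pv0 ?mul0r// expR0 mulr1.
rewrite sum_cell_mass// ln1 subr0 /t mulrC divfK// => hh.
by have := ler_norm h; lra.
Qed.

Lemma cell_kl : kl p q <= h.
Proof.
(* The log-density is the optimal test function; cells of q-mass 0, where it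
   is -oo, get the value ln e, which costs at most e in the log-integral. *)
apply/ler_addgt0Pr => e e0.
have := cell_entropy (fun u => if q u == 0 then ln e else ln (q u / p u)).
rewrite (eq_bigr (fun u => q u * ln (q u / p u))) -/(kl p q); last first.
  by move=> u _; case: eqP => [->|//]; rewrite !mul0r.
set s := \sum_v _ => hs.
have se : s <= 1 + e.
  have -> : 1 + e = \sum_u (q u + p u * e).
    by rewrite big_split/= -mulr_suml !sum_cell_mass// mul1r.
  apply: ler_sum => u _.
  have pu : 0 <= p u by exact: cell_mass_ge0.
  case: eqVneq => [->|qu]; first by rewrite add0r lnK.
  have pu0 : p u != 0 by apply: contra_neq qu; exact: cell_abs_cont.
  have {}pu0 : 0 < p u by rewrite lt_def pu0.
  have qu0 : 0 < q u by rewrite lt_def qu cell_mass_ge0.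
  rewrite lnK ?posrE ?divr_gt0// mulrC divfK ?gt_eqF//.
  by rewrite lerDl mulr_ge0// ltW.
have s0 : 0 < s.
  apply: (@lt_le_trans _ _ (\int[mu]_x
      expR (if q (pi x) == 0 then ln e else ln (q (pi x) / p (pi x))))).
    exact: (Rintegral_expR_gt0 mu (bounded_measurable_fin
      (fun u => if q u == 0 then ln e else ln (q u / p u)) mpi)).
  by rewrite (Rintegral_fin_measurable mpi mu
    (fun u => expR (if q u == 0 then ln e else ln (q u / p u)))).
have : ln s <= e.
  rewrite (@le_trans _ _ (ln (1 + e)))//.
    by rewrite ler_ln// posrE addr_gt0.
  by rewrite le_ln1Dx// (lt_trans _ e0)// ltrN10.
by move: hs; lra.
Qed.

End entropy_of_partition.

Section functional_neighbourhood.
Context {R : realType} {M : ptopologicalType}.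

Lemma functional_neighbourhood (O : set (weak_probability R M)) nu :
  open O -> O nu ->
  exists k (f : 'I_k -> borel M -> R), (forall i, bounded_measurable (f i)) /\
  exists2 e : R, 0 < e & forall nu' : probability (borel M) R,
    (forall i, `|\int[nu']_x f i x -
      \int[(nu : probability (borel M) R)]_x f i x| < e) ->
    O nu'.
Proof.
move=> oO Onu.
pose F : set_system (weak_probability R M) := [set S |
  exists k (f : 'I_k -> borel M -> R), (forall i, bounded_measurable (f i)) /\
  exists2 e : R, 0 < e & forall nu' : probability (borel M) R,
    (forall i, `|\int[nu']_x f i x -
      \int[(nu : probability (borel M) R)]_x f i x| < e) ->
    S nu'].
have FF : Filter F.
  split.
  - by exists 0%N, (fun _ _ => 0); split=> [[]//|]; exists 1.
  - move=> S S' [k [f [bf [e e0 fS]]]] [k' [f' [bf' [e' e'0 fS']]]].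
    have [g [gf gf'] gP] := cat_family f f'.
    exists (k + k')%N, g; split; first exact: gP.
    exists (Num.min e e'); first by rewrite lt_min e0.
    move=> nu' h; split; [apply: fS => i|apply: fS' => i].
      by have := h (lshift k' i); rewrite gf lt_min => /andP[].
    by have := h (rshift k i); rewrite gf' lt_min => /andP[].
  - move=> S S' SS' [k [f [bf [e e0 fS]]]]; exists k, f; split=> //.
    by exists e => // nu' /fS /SS'.
(* Convergence of [F] to [nu] puts every open set around [nu] into [F], and [weak_cvg] reduces it to
   one continuous function at a time. *)
suff : F --> nu by apply; exact: open_nbhs_nbhs.
apply: weak_cvg => phi; apply/cvgrPdist_lt => e e0.
exists 1%N, (fun=> sval phi); split=> [_|].
  exact: bounded_continuous_measurable.
by exists e => // nu' /(_ ord0); rewrite distrC.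
Qed.

End functional_neighbourhood.

(** In use, x and u are the integrals of a test function under the empirical measure and under [nu],
    while y and z are those of its finitely valued approximation. *)
Lemma dist_chain (R : realType) (x y z u e : R) : 0 < e ->
  `|x - y| <= e / 4 -> `|y - z| < e / 4 -> `|u - z| <= e / 4 -> `|x - u| < e.
Proof.
move=> e0; rewrite !ler_norml !ltr_norml => /andP[? ?] /andP[? ?] /andP[? ?].
by apply/andP; split; lra.
Qed.

Section sanov.
Context {R : realType} {M : polishMetricType R} (mu : probability (borel M) R).
Context d {Omega : measurableType d} {P : probability Omega R}.
Context (X : nat -> {RV P >-> borel M}).
Hypotheses (X_indep : mutually_independent X)
  (X_law : forall (i : nat) (A : set (borel M)), measurable A ->
     distribution P (X i) A = mu A).

Let rate (B : set (weak_probability R M)) n : \bar R :=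
  ((n.+1%:R^-1)%:E *
    lne (P [set w | B (empirical_point R (fun i => X i w) n)]))%E.

Lemma sanov_upper_bound (C : set (weak_probability R M)) : closed C ->
  (limn_esup (rate C) <=
    - ereal_inf [set relative_entropy nu mu | nu in C])%E.
Proof.
move=> cC; rewrite leeNr; apply: lee_forall_lt => l lI; rewrite leeNr.
have [k [f [sf hf]]] : exists k (f : 'I_k -> borel M -> R),
    (forall i, fin_simple (f i)) /\
    forall nu, C nu -> exists i, ~ entropy_halfspace mu l (f i) nu.
  apply: finite_halfspace_cover => // nu Cnu; apply: (lt_le_trans lI).
  by apply: ereal_inf_lbound; exists nu.
(* The prefactor is [k.+1] instead of [k] to stay positive when [k] is 0, so that its logarithm is
   meaningful. *)
have PC n : (P [set w | C (empirical_point R (fun i => X i w) n)] <=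
    (k.+1%:R * expR (- l * n.+1%:R))%:E)%E.
  pose E (i : 'I_k) := [set w | ~ entropy_halfspace mu l (f i)
    (empirical_point R (fun i => X i w) n)].
  pose E' j := if insub j is Some i then E i else set0.
  have mE i : measurable (E i).
    by have [] := iid_chernoff X_indep X_law l n (sf i).
  have PE i : (P (E i) <= (expR (- l * n.+1%:R))%:E)%E.
    by have [] := iid_chernoff X_indep X_law l n (sf i).
  have mE' j : measurable (E' j) by rewrite /E'; case: insub.
  have mC : measurable [set w | C (empirical_point R (fun i => X i w) n)].
    rewrite -[X in measurable X]setCK; apply: measurableC.
    exact: (empirical_measurable X n (closed_openC cC)).
  apply: (@le_trans _ _ (\sum_(j < k) P (E' j))%E).
    apply: content_subadditive => // w /= /hf[i Ei].
    by rewrite -bigcup_mkord; exists i => //=; rewrite /E' valK.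
  apply: (@le_trans _ _ (\sum_(j < k) (expR (- l * n.+1%:R))%:E)%E).
    by apply: lee_sum => j _; rewrite /E' valK.
  rewrite sumEFin lee_fin sumr_const card_ord -[leLHS]mulr_natl.
  by rewrite ler_wpM2r ?expR_ge0// ler_nat.
apply/lee_addgt0Pr => e e0; apply: limn_esup_le.
have [N hN] := divn_eventually_le (ln k.+1%:R) e0.
exists N => n Nn; apply: (le_trans (rate_le _ _ (PC n))) => //.
by rewrite -EFinN -EFinD lee_fin addrC lerD2l hN.
Qed.

Lemma sanov_lower_bound (O : set (weak_probability R M)) : open O ->
  (- ereal_inf [set relative_entropy nu mu | nu in O] <=
    limn_einf (rate O))%E.
Proof.
move=> oO; rewrite leeNl; apply: le_ereal_inf_tmp => _ [nu Onu <-].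
rewrite leeNl.
have := relative_entropy_ge0 (nu : probability (borel M) R) mu.
(* A [nu] of infinite entropy gives the trivial bound -oo. *)
case hE : relative_entropy => [h| |] // _; last by rewrite leNye.
have hH : (relative_entropy (nu : probability (borel M) R) mu <= h%:E)%E.
  by rewrite hE.
have [k [f [bf [e1 e10 fO]]]] := functional_neighbourhood oO Onu.
have e14 : 0 < e1 / 4 by rewrite divr_gt0.
have [V [pi [a [mpi fa]]]] := finite_approx_seq bf e14.
pose p := cell_mass mu pi.
pose q := cell_mass (nu : probability (borel M) R) pi.
apply/lee_addgt0Pr => e e0.
(* The bound e1/4 keeps typical words in the neighbourhood of [nu], and e/2 is the loss allowed in
   the exponent; the other e/2 absorbs the factor 1/2 in the mass of the typical words. *)
pose e2 := Num.min (e1 / 4) (e / 2).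
have e20 : 0 < e2 by rewrite lt_min e14 divr_gt0.
pose fs := [seq a i | i <- enum 'I_k].
have p0 v : 0 <= p v by exact: cell_mass_ge0.
have q0 v : 0 <= q v by exact: cell_mass_ge0.
have [N hN] := typical_lower_bound p0 q0 (sum_cell_mass mpi _)
  (cell_abs_cont mpi hH) fs e20.
have PO n : (N <= n)%N -> ((2^-1 * expR (- (kl p q + e2) * n.+1%:R))%:E <=
    P [set w | O (empirical_point R (fun i => X i w) n)])%E.
  move=> /hN {}hN; rewrite -lee_fin in hN; apply: (le_trans hN).
  rewrite -(word_law X_indep X_law mpi (fun v => typical q fs e2 v)).
  apply: le_measure.
  - rewrite inE; exact: (fin_measurable_preimage
      (fin_measurable_word X mpi (n := n.+1)) [set v | typical q fs e2 v]).
  - by rewrite inE; exact: empirical_measurable.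
  move=> w /= /allP typ; apply: fO => i.
  have ba := bounded_measurable_fin (a i) mpi.
  have := Rintegral_close (@empirical_measure _ (borel M) R (fun i => X i w) n)
    (bf i) ba (fa i).
  have := Rintegral_close (nu : probability (borel M) R) (bf i) ba (fa i).
  have /typ : a i \in fs by apply: map_f; rewrite mem_enum.
  rewrite /= (Rintegral_empirical_word X (a i) w n mpi).
  rewrite (Rintegral_fin_measurable mpi nu (a i)) -/q.
  rewrite /e2 lt_min => /andP[+ _].
  by move=> xy uz yz; exact: dist_chain e10 yz xy uz.
have [N' hN'] := divn_eventually_le (- ln (2^-1 : R)) (divr_gt0 e0 (ltr0n _ 2)).
rewrite -leeBlDr//; apply: limn_einf_ge.
exists (maxn N N') => n; rewrite geq_max => /andP[Nn N'n].
apply: le_trans (rate_ge _ (PO n Nn)); last by rewrite invr_gt0.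
have e2e : e2 <= e / 2 by rewrite /e2 ge_min lexx orbT.
rewrite -EFinN -EFinB lee_fin.
rewrite (_ : - h - e = - (e / 2) - (h + e / 2)); last by lra.
apply: lerB; last exact: lerD (cell_kl mpi hH) e2e.
by rewrite lerNl -mulNr hN'.
Qed.

End sanov.

Local Close Scope ring_scope.
Local Open Scope ereal_scope.

Theorem theorem1p1 (R : realType) (M : polishMetricType R)
    (mu : probability (borel M) R)
    (d : measure_display) (Omega : measurableType d) (P : probability Omega R)
    (X : nat -> {RV P >-> borel M})
    (X_indep : mutually_independent X)
    (X_law : forall (i : nat) (A : set (borel M)),
       measurable A -> distribution P (X i) A = mu A) :
  (forall O : set (weak_probability R M), open O ->
     - ereal_inf [set relative_entropy nu mu | nu in O] <=
     limn_einf (fun n : nat => (n.+1%:R^-1)%:E *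
       lne (P [set w | O (empirical_point R (fun i => X i w) n)])))
  /\
  (forall C : set (weak_probability R M), closed C ->
     limn_esup (fun n : nat => (n.+1%:R^-1)%:E *
       lne (P [set w | C (empirical_point R (fun i => X i w) n)])) <=
     - ereal_inf [set relative_entropy nu mu | nu in C]).
Proof.
split=> [U oU|C cC].
  exact: sanov_lower_bound.
exact: sanov_upper_bound.
Qed.
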